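(* Let $\sum_{n\in\mathbb{N}} q^n a_n$, with $a_n\in\mathbb{H}$, be a regular power series having radius of convergence $R$. Then its sum defines a $\sigma$-analytic function on $B(0,R)=\{q\in\mathbb{H}:|q|<R\}$.
   Context: $\mathbb{H}$ is the skew field of real quaternions, with real part $Re(q)$, imaginary part $Im(q)$ and Euclidean modulus $|q|$. Let $\mathbb{S}=\{q\in\mathbb{H}:q^2=-1\}$ and, for $I\in\mathbb{S}$, $L_I=\mathbb{R}+I\mathbb{R}$ (a ''complex line''). The radius of convergence $R\in[0,+\infty]$ of $\sum_n q^na_n$ is given by $1/R=\limsup_{n\to\infty}|a_n|^{1/n}$. For $p,q\in\mathbb{H}$ put $\omega(q,p)=\sqrt{[Re(q)-Re(p)]^2+[|Im(q)|+|Im(p)|]^2}$, and let $\sigma(q,p)=|q-p|$ if $p,q$ lie in a common complex line $L_I$, and $\sigma(q,p)=\omega(q,p)$ otherwise. The map $\sigma$ is a distance on $\mathbb{H}$ whose topology is finer than the Euclidean one; ''$\sigma$-open'', ''$\sigma$-neighborhood'' refer to the topology of $\sigma$. The regular multiplication $*$ of polynomials/power series with right coefficients is $\left(\sum_n q^n a_n\right)*\left(\sum_n q^n b_n\right)=\sum_n q^n\sum_{k=0}^n a_kb_{n-k}$, and $(q-p)^{*n}$ is the $n$-th power of $q-p$ with respect to $*$ (with $(q-p)^{*0}=1$). Let $\Omega\subseteq\mathbb{H}$ be $\sigma$-open. A function $f:\Omega\to\mathbb{H}$ is $\sigma$-analytic at $p\in\Omega$ if there exist a $\sigma$-neighborhood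 $U$ of $p$ in $\Omega$ and a series $\sum_n(q-p)^{*n}b_n$ ($b_n\in\mathbb{H}$), converging in $U$ (with respect to the Euclidean norm), such that $f(q)=\sum_n(q-p)^{*n}b_n$ for all $q\in U$; $f$ is $\sigma$-analytic if it is so at all $p\in\Omega$. *)

(* Defs.v *)
From HB Require Import structures.
From mathcomp Require Import all_boot all_order all_algebra.
From mathcomp Require Import all_classical all_reals all_analysis.
From mathcomp Require Import ring lra.

Set Implicit Arguments.
Unset Strict Implicit.
Unset Printing Implicit Defensive.

Import Order.TTheory GRing.Theory Num.Theory.
Import numFieldNormedType.Exports.

Local Open Scope classical_set_scope.
Local Open Scope ring_scope.

(* Quat x y z t stands for x + y i + z j + t k. *)
Record quat (R : Type) := Quat { qRe : R; qi : R; qj : R; qk : R }.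

Section Quaternions.
Variable R : realType.
Local Notation H := (quat R).
Implicit Types (p q r : H) (x y : R).

Lemma quat_ext p q :
  qRe p = qRe q -> qi p = qi q -> qj p = qj q -> qk p = qk q -> p = q.
Proof. by case: p => ????; case: q => ???? /= -> -> -> ->. Qed.

Definition tuple_of_quat q := (qRe q, qi q, qj q, qk q).
Definition quat_of_tuple (u : R * R * R * R) : H :=
  Quat u.1.1.1 u.1.1.2 u.1.2 u.2.
Lemma tuple_of_quatK : cancel tuple_of_quat quat_of_tuple.
Proof. by case. Qed.

HB.instance Definition _ := Choice.copy H (can_type tuple_of_quatK).

Definition qadd p q :=
  Quat (qRe p + qRe q) (qi p + qi q) (qj p + qj q) (qk p + qk q).
Definition qopp q := Quat (- qRe q) (- qi q) (- qj q) (- qk q).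
Definition qmul p q := Quat
  (qRe p * qRe q - qi p * qi q - qj p * qj q - qk p * qk q)
  (qRe p * qi q + qi p * qRe q + qj p * qk q - qk p * qj q)
  (qRe p * qj q - qi p * qk q + qj p * qRe q + qk p * qi q)
  (qRe p * qk q + qi p * qj q - qj p * qi q + qk p * qRe q).
Definition qscale x q := Quat (x * qRe q) (x * qi q) (x * qj q) (x * qk q).

Lemma qaddA : associative qadd.
Proof. by move=> p q r; apply: quat_ext => /=; ring. Qed.
Lemma qaddC : commutative qadd.
Proof. by move=> p q; apply: quat_ext => /=; ring. Qed.
Lemma qadd0 : left_id (Quat 0 0 0 0) qadd.
Proof. by move=> p; apply: quat_ext => /=; ring. Qed.
Lemma qaddN : left_inverse (Quat 0 0 0 0) qopp qadd.
Proof. by move=> p; apply: quat_ext => /=; ring. Qed.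

HB.instance Definition _ := GRing.isZmodule.Build H qaddA qaddC qadd0 qaddN.

Lemma qmulA : associative qmul.
Proof. by move=> p q r; apply: quat_ext => /=; ring. Qed.
Lemma qmul1l : left_id (Quat 1 0 0 0) qmul.
Proof. by move=> p; apply: quat_ext => /=; ring. Qed.
Lemma qmul1r : right_id (Quat 1 0 0 0) qmul.
Proof. by move=> p; apply: quat_ext => /=; ring. Qed.
Lemma qmulDl : left_distributive qmul +%R.
Proof. by move=> p q r; apply: quat_ext => /=; ring. Qed.
Lemma qmulDr : right_distributive qmul +%R.
Proof. by move=> p q r; apply: quat_ext => /=; ring. Qed.
Lemma qone_neq0 : Quat 1 0 0 0 != 0 :> H.
Proof. by apply/eqP => -[/eqP]; rewrite oner_eq0. Qed.

HB.instance Definition _ := GRing.Zmodule_isNzRing.Build H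
  qmulA qmul1l qmul1r qmulDl qmulDr qone_neq0.

Lemma qscaleA x y q : qscale x (qscale y q) = qscale (x * y) q.
Proof. by apply: quat_ext => /=; ring. Qed.
Lemma qscale1 : left_id 1 qscale.
Proof. by move=> p; apply: quat_ext => /=; ring. Qed.
Lemma qscaleDr : right_distributive qscale +%R.
Proof. by move=> x p q; apply: quat_ext => /=; ring. Qed.
Lemma qscaleDl q : {morph qscale^~ q : x y / x + y}.
Proof. by move=> x y; apply: quat_ext => /=; ring. Qed.

HB.instance Definition _ := GRing.Zmodule_isLmodule.Build R H
  qscaleA qscale1 qscaleDr qscaleDl.

Lemma qscaleAl x p q : x *: (p * q) = (x *: p) * q.
Proof. by apply: quat_ext => /=; ring. Qed.

HB.instance Definition _ := GRing.Lmodule_isLalgebra.Build R H qscaleAl.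

Lemma qscaleAr x p q : x *: (p * q) = p * (x *: q).
Proof. by apply: quat_ext => /=; ring. Qed.

HB.instance Definition _ := GRing.Lalgebra_isAlgebra.Build R H qscaleAr.

Lemma quat0E : (0 : H) = Quat 0 0 0 0. Proof. by []. Qed.
Lemma quat1E : (1 : H) = Quat 1 0 0 0. Proof. by []. Qed.
Lemma quatDE p q : p + q = qadd p q. Proof. by []. Qed.
Lemma quatNE p : - p = qopp p. Proof. by []. Qed.
Lemma quatME p q : p * q = qmul p q. Proof. by []. Qed.
Lemma quatZE x p : x *: p = qscale x p. Proof. by []. Qed.
Definition quatE := (quat0E, quat1E, quatDE, quatNE, quatME, quatZE).

Definition qnorm q :=
  Num.sqrt (qRe q ^+ 2 + qi q ^+ 2 + qj q ^+ 2 + qk q ^+ 2).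

Lemma sqrt_triangle (A B C : R) : 0 <= A -> 0 <= B -> C ^+ 2 <= A * B ->
  Num.sqrt (A + B + 2 * C) <= Num.sqrt A + Num.sqrt B.
Proof.
move=> A0 B0 CAB.
have AB : `|C| <= Num.sqrt A * Num.sqrt B.
  by rewrite -sqrtrM// -sqrtr_sqr ler_sqrt// mulr_ge0.
rewrite -[leRHS]ger0_norm ?addr_ge0 ?sqrtr_ge0// -sqrtr_sqr.
rewrite ler_sqrt ?sqr_ge0// sqrrD !sqr_sqrtr//.
have := le_trans (ler_norm C) AB; lra.
Qed.

Lemma qnormD p q : qnorm (p + q) <= qnorm p + qnorm q.
Proof.
case: p q => [a b c d] [a' b' c' d']; rewrite quatE /qnorm /=.
have -> : (a + a') ^+ 2 + (b + b') ^+ 2 + (c + c') ^+ 2 + (d + d') ^+ 2 =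
  (a ^+ 2 + b ^+ 2 + c ^+ 2 + d ^+ 2) + (a' ^+ 2 + b' ^+ 2 + c' ^+ 2 + d' ^+ 2)
  + 2 * (a * a' + b * b' + c * c' + d * d') by ring.
apply: sqrt_triangle; rewrite ?addr_ge0 ?sqr_ge0// -subr_ge0.
have -> : (a ^+ 2 + b ^+ 2 + c ^+ 2 + d ^+ 2) *
    (a' ^+ 2 + b' ^+ 2 + c' ^+ 2 + d' ^+ 2) -
    (a * a' + b * b' + c * c' + d * d') ^+ 2 =
  (a * b' - b * a') ^+ 2 + (a * c' - c * a') ^+ 2 + (a * d' - d * a') ^+ 2 +
  (b * c' - c * b') ^+ 2 + (b * d' - d * b') ^+ 2 + (c * d' - d * c') ^+ 2.
  by ring.
by rewrite !addr_ge0 ?sqr_ge0.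
Qed.

Lemma qnormZ x q : qnorm (x *: q) = `|x| * qnorm q.
Proof.
rewrite quatE /qnorm /= -sqrtr_sqr -sqrtrM ?sqr_ge0//; congr Num.sqrt; ring.
Qed.

Lemma qnorm0_eq0 q : qnorm q = 0 -> q = 0.
Proof.
case: q => a b c d /eqP; rewrite /qnorm /= sqrtr_eq0 => le0.
have [Ha Hb Hc Hd] : [/\ a ^+ 2 = 0, b ^+ 2 = 0, c ^+ 2 = 0 & d ^+ 2 = 0].
  have := sqr_ge0 a; have := sqr_ge0 b; have := sqr_ge0 c; have := sqr_ge0 d.
  by split; lra.
by apply: quat_ext => /=; apply/eqP; rewrite -sqrf_eq0; apply/eqP.
Qed.

HB.instance Definition _ := Lmodule_isNormed.Build R H
  qnormD qnormZ qnorm0_eq0.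

Lemma quat_normE q : `|q| = qnorm q. Proof. by []. Qed.

Definition qIm q : H := Quat 0 (qi q) (qj q) (qk q).

Definition imag_sphere : set H := [set I | I ^+ 2 = -1].

Definition complex_line (I : H) : set H :=
  [set q | exists x y, q = x%:A + y *: I].

Definition same_line p q :=
  exists2 I, imag_sphere I & complex_line I p /\ complex_line I q.

Definition omega q p :=
  Num.sqrt ((qRe q - qRe p) ^+ 2 + (`|qIm q| + `|qIm p|) ^+ 2).

Definition sigma q p : R :=
  if `[< same_line q p >] then `|q - p| else omega q p.

Lemma qIm_eq0 q : qIm q = 0 -> q = (qRe q)%:A.
Proof.
by case: q => a b c d; rewrite !quatE => -[-> -> ->]; apply: quat_ext => /=;
  ring.
Qed.

Lemma sqr_qIm q : `|qIm q| ^+ 2 = qi q ^+ 2 + qj q ^+ 2 + qk q ^+ 2.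
Proof.
by rewrite quat_normE /qnorm sqr_sqrtr /= ?addr_ge0 ?sqr_ge0// expr0n add0r.
Qed.

Lemma complex_line_exists q : exists2 I, imag_sphere I & complex_line I q.
Proof.
have [q0|q0] := eqVneq (qIm q) 0.
  exists (Quat 0 1 0 0).
    by rewrite /imag_sphere /= expr2 !quatE; apply: quat_ext => /=; ring.
  by exists (qRe q), 0; rewrite scale0r addr0; apply: qIm_eq0.
have n0 : `|qIm q| != 0 by rewrite normr_eq0.
exists (`|qIm q|^-1 *: qIm q); last first.
  exists (qRe q), `|qIm q|; rewrite scalerA divff// scale1r.
  by rewrite !quatE; apply: quat_ext => /=; ring.
have := sqr_qIm q; move: n0; set N := `|_| => n0 NE.
rewrite /imag_sphere /= expr2 -scalerAl -scalerAr scalerA -invfM -expr2.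
have -> : qIm q * qIm q = (N ^+ 2) *: (- 1).
  by rewrite NE !quatE; apply: quat_ext => /=; ring.
by rewrite scalerA mulVf ?scale1r// sqrf_eq0.
Qed.

Lemma same_lineC p q : same_line p q -> same_line q p.
Proof. by case=> I SI [? ?]; exists I. Qed.

Lemma same_line_refl q : same_line q q.
Proof. by have [I SI qI] := complex_line_exists q; exists I. Qed.

Lemma same_line_real q r : qIm r = 0 -> same_line q r.
Proof.
move=> r0; have [I SI qI] := complex_line_exists q; exists I => //; split=> //.
by exists (qRe r), 0; rewrite scale0r addr0; apply: qIm_eq0.
Qed.

Lemma imag_sphereP I : imag_sphere I ->
  qRe I = 0 /\ qi I ^+ 2 + qj I ^+ 2 + qk I ^+ 2 = 1.
Proof.
case: I => a b c d; rewrite /imag_sphere /= expr2 !quatE => -[h1 h2 h3 h4].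
have [a0|a0] := eqVneq a 0; first by split=> //; nra.
have cancela y : a * y + y * a = 0 -> y = 0.
  by move=> e; apply: (mulfI a0); lra.
have [b0 c0 d0] : [/\ b = 0, c = 0 & d = 0] by split; apply: cancela; lra.
by exfalso; rewrite b0 c0 d0 in h1; nra.
Qed.

Lemma same_line_trans r p q : qIm r != 0 ->
  same_line p r -> same_line r q -> same_line p q.
Proof.
move=> r0 [I SI [pI [u [v rI]]]] [J SJ [[u' [v' rJ]] [x [y qJ]]]].
exists I => //; split=> //.
have [] := imag_sphereP SI; have [] := imag_sphereP SJ.
move: r0 rI rJ; rewrite {}qJ; case: I J r {pI SI SJ} => [a b c d] [a' b' c' d'].
case=> [re ri rj rk] /= + + + /eqP a'0 J1 /eqP a0 I1.
rewrite (eqP a0) (eqP a'0) {a a0 a' a'0} !quatE => r0 /= [_ ib ic id].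
move=> [_ jb jc jd].
have vv : v ^+ 2 = v' ^+ 2.
  have -> : v ^+ 2 = ri ^+ 2 + rj ^+ 2 + rk ^+ 2.
    transitivity (v ^+ 2 * (b ^+ 2 + c ^+ 2 + d ^+ 2)); first by rewrite I1 mulr1.
    by rewrite ib ic id; ring.
  transitivity (v' ^+ 2 * (b' ^+ 2 + c' ^+ 2 + d' ^+ 2)); last by rewrite J1 mulr1.
  by rewrite jb jc jd; ring.
have v'0 : v' != 0.
  apply: contra r0 => /eqP v'0; apply/eqP/quat_ext => //=.
  - by rewrite jb v'0; ring.
  - by rewrite jc v'0; ring.
  - by rewrite jd v'0; ring.
exists x, (y * (v / v')); rewrite !quatE; apply: quat_ext => /=.
- by ring.
- have -> : b' = v / v' * b by apply: (mulfI v'0); rewrite mulrA [v' * (_ / _)]mulrC divfK//; lra.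
  by ring.
- have -> : c' = v / v' * c by apply: (mulfI v'0); rewrite mulrA [v' * (_ / _)]mulrC divfK//; lra.
  by ring.
- have -> : d' = v / v' * d by apply: (mulfI v'0); rewrite mulrA [v' * (_ / _)]mulrC divfK//; lra.
  by ring.
Qed.

Lemma quat_normP q :
  `|q| = Num.sqrt (qRe q ^+ 2 + `|qIm q| ^+ 2).
Proof. by rewrite sqr_qIm quat_normE /qnorm !addrA. Qed.

Lemma qImB p q : qIm (p - q) = qIm p - qIm q.
Proof. by rewrite !quatE; apply: quat_ext => /=; ring. Qed.

Lemma hypot_triangle (a b c d : R) :
  Num.sqrt ((a + c) ^+ 2 + (b + d) ^+ 2) <=
  Num.sqrt (a ^+ 2 + b ^+ 2) + Num.sqrt (c ^+ 2 + d ^+ 2).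
Proof.
have -> : (a + c) ^+ 2 + (b + d) ^+ 2 =
  (a ^+ 2 + b ^+ 2) + (c ^+ 2 + d ^+ 2) + 2 * (a * c + b * d) by ring.
apply: sqrt_triangle; rewrite ?addr_ge0 ?sqr_ge0// -subr_ge0.
have -> : (a ^+ 2 + b ^+ 2) * (c ^+ 2 + d ^+ 2) - (a * c + b * d) ^+ 2 =
  (a * d - b * c) ^+ 2 by ring.
exact: sqr_ge0.
Qed.

Lemma hypot_le (a b c : R) : b ^+ 2 <= c ^+ 2 ->
  Num.sqrt (a ^+ 2 + b ^+ 2) <= Num.sqrt (a ^+ 2 + c ^+ 2).
Proof. by move=> bc; rewrite ler_sqrt ?addr_ge0 ?sqr_ge0// lerD2l. Qed.

Lemma norm_ge_hypot q p :
  Num.sqrt ((qRe q - qRe p) ^+ 2 + (`|qIm q| - `|qIm p|) ^+ 2) <= `|q - p|.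
Proof.
rewrite (quat_normP (q - p)); apply: hypot_le.
rewrite qImB -(real_normK (num_real (`|qIm q| - _))) ler_pXn2r ?nnegrE//.
exact: ler_dist_dist.
Qed.

Lemma norm_le_omega q p : `|q - p| <= omega q p.
Proof.
rewrite quat_normP; apply: hypot_le; rewrite qImB ler_pXn2r ?nnegrE ?addr_ge0//.
exact: ler_normB.
Qed.

Lemma omegaC q p : omega q p = omega p q.
Proof. by rewrite /omega (addrC `|qIm q|); congr Num.sqrt; ring. Qed.

Lemma sigma_line q p : same_line q p -> sigma q p = `|q - p|.
Proof. by move=> h; rewrite /sigma asboolT. Qed.

Lemma sigma_noline q p : ~ same_line q p -> sigma q p = omega q p.
Proof. by move=> h; rewrite /sigma asboolF. Qed.

Lemma norm_le_sigma q p : `|q - p| <= sigma q p.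
Proof. by rewrite /sigma; case: ifP => // _; exact: norm_le_omega. Qed.

Lemma sigmaxx q : sigma q q = 0.
Proof. by rewrite (sigma_line (same_line_refl q)) subrr normr0. Qed.

Lemma sigma_eq0 q p : sigma q p = 0 -> q = p.
Proof.
move=> s0; apply/eqP; rewrite -subr_eq0 -normr_le0 -s0; exact: norm_le_sigma.
Qed.

Lemma sigma_sym q p : sigma q p = sigma p q.
Proof.
have [qp|qp] := pselect (same_line q p).
  by rewrite (sigma_line qp) (sigma_line (same_lineC qp)) distrC.
have pq : ~ same_line p q by move=> /same_lineC.
by rewrite (sigma_noline qp) (sigma_noline pq) omegaC.
Qed.

Lemma omega_triangle_line p q r : omega p q <= `|p - r| + omega r q.
Proof.
apply: (le_trans _ (lerD (norm_ge_hypot p r) (lexx _))).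
apply: le_trans (hypot_triangle _ _ _ _).
rewrite /omega le_eqVlt; apply/orP; left; apply/eqP; congr Num.sqrt; ring.
Qed.

Lemma sigma_triangle r p q : sigma p q <= sigma p r + sigma r q.
Proof.
have [pq|pq] := pselect (same_line p q).
  rewrite (sigma_line pq) (le_trans (ler_distD r p q))//.
  by apply: lerD; exact: norm_le_sigma.
rewrite (sigma_noline pq).
have [rq|rq] := pselect (same_line r q); last first.
  rewrite (sigma_noline rq) (le_trans (omega_triangle_line p q r))//.
  by rewrite lerD2r; exact: norm_le_sigma.
have [pr|pr] := pselect (same_line p r); last first.
  rewrite (sigma_noline pr) (sigma_line rq) omegaC.
  rewrite (le_trans (omega_triangle_line q p r))// addrC omegaC distrC.
  by rewrite lerD2r.
have [r0|r0] := eqVneq (qIm r) 0; last by case: pq; apply: same_line_trans r0 pr rq.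
rewrite (sigma_line pr) (sigma_line rq).
have -> : `|r - q| = omega r q.
  by rewrite quat_normP /omega qImB r0 normr0 sub0r normrN add0r.
exact: omega_triangle_line.
Qed.

(* A copy of the quaternions carrying the topology of sigma; quat R itself
   carries the Euclidean one. *)
Definition squat : Type := H.

HB.instance Definition _ := Choice.on squat.
HB.instance Definition _ := isMetric.Build R squat
  sigmaxx sigma_eq0 sigma_sym sigma_triangle.

Definition sigma_open (Omega : set H) := open (Omega : set squat).

Definition sigma_nbhs p (U : set H) := nbhs (p : squat) (U : set squat).

(* {poly H} has the regular multiplication, but its p.[x] puts the
   coefficients on the left of the powers of x. *)
Definition reg_eval (P : {poly H}) q := \sum_(n < size P) q ^+ n * P`_n.

Definition reg_pow p n : {poly H} := ('X - p%:P) ^+ n.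

Definition sigma_analytic_at (Omega : set H) (f : H -> H) p :=
  exists (U : set H) (b : nat -> H),
    [/\ sigma_nbhs p U, U `<=` Omega &
      forall q, U q ->
        series (fun n => reg_eval (reg_pow p n) q * b n) @ \oo --> f q].

Definition sigma_analytic (Omega : set H) (f : H -> H) :=
  sigma_open Omega /\ forall p, Omega p -> sigma_analytic_at Omega f p.

Definition power_series (a : nat -> H) q : nat -> H :=
  series (fun n => q ^+ n * a n).

(* The inverse on \bar R sends 0 to +oo and +oo to 0; the term of index 0 does
   not affect the limsup. *)
Definition convergence_radius (a : nat -> H) : \bar R :=
  ((limn_esup (fun n => (`|a n| `^ n%:R^-1)%:E))^-1)%E.

End Quaternions.

(* Main.v *)
Require Import Defs.
From mathcomp Require Import all_boot all_order all_algebra.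
From mathcomp Require Import all_classical all_reals all_analysis.
From mathcomp Require Import ring lra.
Import Order.TTheory GRing.Theory Num.Theory.
Import numFieldNormedType.Exports.
Local Open Scope classical_set_scope.
Local Open Scope ring_scope.

(* In the regular polynomial ring the variable is central, so the binomial
   formula expands q^n as the sum over k of (q-p)^{*k} C(n,k) p^(n-k). Since
   |(q-p)^{*k}| <= 2 sigma(q,p)^k, the double series obtained by inserting this
   in the power series is dominated by 2 |a_n| (|p| + sigma(q,p))^n, which is
   summable as soon as |p| + sigma(q,p) < R; exchanging the sums gives the
   expansion at p on a sigma-ball, with coefficients
   b_k = sum over n of C(n,k) p^(n-k) a_n. *)

(** * Multiplicativity of the modulus and complex lines *)

Section QuaternionNorm.
Context {R : realType}.
Implicit Types (p q : quat R).

Lemma qnormM p q : `|p * q| = `|p| * `|q|.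
Proof.
rewrite !quat_normE /qnorm -sqrtrM ?addr_ge0 ?sqr_ge0//.
by congr Num.sqrt; rewrite quatE /=; ring.
Qed.

Lemma qnorm1 : `|1 : quat R| = 1.
Proof. by rewrite quat_normE /qnorm /= expr1n !expr0n /= !addr0 sqrtr1. Qed.

Lemma qnormX q n : `|q ^+ n| = `|q| ^+ n.
Proof. by elim: n => [|n IH]; rewrite ?qnorm1// !exprS qnormM IH. Qed.

Lemma qnorm_imag (I : quat R) : imag_sphere I -> `|I| = 1.
Proof.
move=> /imag_sphereP[I0 I1].
by rewrite quat_normE /qnorm I0 expr0n add0r I1 sqrtr1.
Qed.

Lemma complex_line_Re (I : quat R) x y :
  imag_sphere I -> qRe (x%:A + y *: I) = x.
Proof. by move=> /imag_sphereP[I0 _]; rewrite !quatE /= I0; ring. Qed.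

Lemma complex_line_Im (I : quat R) x y :
  imag_sphere I -> `|qIm (x%:A + y *: I)| = `|y|.
Proof.
move=> SI; have [I0 _] := imag_sphereP SI.
rewrite -[RHS]mulr1 -(qnorm_imag _ SI) -normrZ; congr `|_|.
by rewrite !quatE; apply: quat_ext => /=; rewrite ?I0; ring.
Qed.

Lemma complex_line_comm I p q :
  complex_line I p -> complex_line I q -> p * q = q * p.
Proof.
by move=> [x [y ->]] [x' [y' ->]]; rewrite !quatE; apply: quat_ext => /=; ring.
Qed.

End QuaternionNorm.

(** Since [I * I = J * J = - 1], both [J * (1 - J * I)] and [(1 - J * I) * I] equal [J + I]. With
    [c = 2^-1] these factors are the weights of the representation formula. *)
Lemma complex_line_intertwine {K : comNzRingType} {A : algType K} (I J : A)
    (c x y : K) :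
    I * I = - 1 -> J * J = - 1 ->
  (x%:A + y *: J) * (c *: (1 - J * I)) =
  (c *: (1 - J * I)) * (x%:A + y *: I).
Proof.
move=> II JJ; rewrite -scalerAl -scalerAr [in LHS]mulrDl [in RHS]mulrDr.
rewrite -!scalerAl -!scalerAr mul1r mulr1; congr (_ *: (_ + _ *: _)).
rewrite mulrBr mulrBl mulr1 mul1r mulrA JJ -mulrA II.
by rewrite mulN1r mulrN1 !opprK addrC.
Qed.

(** * Evaluation of regular polynomials and the bound on regular powers *)

Section RegularEvaluation.
Context {R : realType}.
Implicit Types (P Q : {poly (quat R)}) (p q c : quat R).

Lemma reg_eval_widen N P q : (size P <= N)%N ->
  reg_eval P q = \sum_(n < N) q ^+ n * P`_n.
Proof.
move=> sN; rewrite /reg_eval (big_ord_widen N (fun n => q ^+ n * P`_n))//.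
rewrite big_mkcond /=; apply: eq_bigr => i _; case: ltnP => // si.
by rewrite nth_default ?mulr0.
Qed.

Lemma reg_evalD P Q q : reg_eval (P + Q) q = reg_eval P q + reg_eval Q q.
Proof.
pose N := maxn (size P) (size Q).
rewrite !(reg_eval_widen N) ?leq_maxl ?leq_maxr ?size_polyD//.
by rewrite -big_split; apply: eq_bigr => i _; rewrite coefD mulrDr.
Qed.

Lemma reg_evalMC P c q : reg_eval (P * c%:P) q = reg_eval P q * c.
Proof.
rewrite (reg_eval_widen (size P)); last first.
  rewrite (leq_trans (size_polyMleq _ _))// -subn1 leq_subLR addnC leq_add2r.
  exact: size_polyC_leq1.
by rewrite big_distrl; apply: eq_bigr => i _; rewrite coefMC mulrA.
Qed.

Lemma reg_evalMX P q : reg_eval (P * 'X) q = q * reg_eval P q.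
Proof.
rewrite (reg_eval_widen (size P).+1); last first.
  by rewrite (leq_trans (size_polyMleq _ _))// size_polyX addn2.
rewrite big_ord_recl coefMX mulr0 add0r big_distrr; apply: eq_bigr => i _.
by rewrite coefMX /= exprS mulrA.
Qed.

Lemma reg_eval0 q : reg_eval 0 q = 0.
Proof. by rewrite /reg_eval size_poly0 big_ord0. Qed.

Lemma reg_eval1 q : reg_eval 1 q = 1.
Proof. by rewrite /reg_eval size_poly1 big_ord1 coef1 mulr1 expr0. Qed.

Lemma reg_evalXn n q : reg_eval 'X^n q = q ^+ n.
Proof.
elim: n => [|n IH]; first by rewrite !expr0 reg_eval1.
by rewrite exprSr reg_evalMX IH exprS.
Qed.

Lemma reg_eval_sum (I : Type) (r : seq I) (F : I -> {poly (quat R)}) q :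
  reg_eval (\sum_(i <- r) F i) q = \sum_(i <- r) reg_eval (F i) q.
Proof.
apply: (big_morph (fun P => reg_eval P q)); last exact: reg_eval0.
by move=> P Q; rewrite reg_evalD.
Qed.

(** Evaluation is not multiplicative: the central variable contributes [q] on the left, while the
    constant [p] stays on the right. *)
Lemma reg_eval_powS p q k : reg_eval (reg_pow p k.+1) q =
  q * reg_eval (reg_pow p k) q - reg_eval (reg_pow p k) q * p.
Proof.
rewrite /reg_pow exprSr mulrBr -mulrN -polyCN.
by rewrite reg_evalD reg_evalMX reg_evalMC mulrN.
Qed.

Lemma reg_eval_binomial p q n : q ^+ n =
  \sum_(k < n.+1) reg_eval (reg_pow p k) q * (p ^+ (n - k) *+ 'C(n, k)).
Proof.
rewrite -reg_evalXn.
have cp : GRing.comm p%:P ('X - p%:P).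
  by rewrite /GRing.comm mulrBl mulrBr (commr_polyX p%:P).
have -> : 'X^n = (p%:P + ('X - p%:P)) ^+ n by rewrite addrC subrK.
rewrite exprDn_comm// reg_eval_sum; apply: eq_bigr => k _.
rewrite -reg_evalMC polyCMn polyC_exp -mulrnAr; congr reg_eval.
rewrite !mulrnAr; congr (_ *+ _).
exact/commrX/commr_sym/commrX.
Qed.

(** By induction on [k]: [q] moves past the weights as [u] and [v], and [p], commuting with these,
    slides through the powers to complete the next factors [u - p] and [v - p]. *)
Lemma reg_eval_pow_split (al be u v p q : quat R) k : al + be = 1 ->
    q * al = al * u -> q * be = be * v -> u * p = p * u -> v * p = p * v ->
  reg_eval (reg_pow p k) q = al * (u - p) ^+ k + be * (v - p) ^+ k.
Proof.
move=> ab qa qb up vp; elim: k => [|k IH].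
  by rewrite /reg_pow !expr0 reg_eval1 !mulr1 ab.
have comm w : w * p = p * w -> (w - p) ^+ k * p = p * (w - p) ^+ k.
  move=> wp; apply/esym/commrX; rewrite /GRing.comm mulrBl mulrBr wp//.
rewrite reg_eval_powS IH mulrDr mulrDl !mulrA qa qb -!mulrA.
rewrite (comm u up) (comm v vp) !exprS !mulrBl !mulrBr opprD addrACA.
by [].
Qed.

(* Off the line of p, the representation formula writes the regular power as a
   combination of ordinary powers (u - p)^k and (v - p)^k, where u and v are the
   two points of the line of p with the real part and the modulus of the
   imaginary part of q. *)
Lemma norm_reg_pow p q k :
  `|reg_eval (reg_pow p k) q| <= 2 * sigma q p ^+ k.
Proof.
have [qp|nqp] := pselect (same_line q p).
  rewrite (sigma_line qp); case: qp => I SI [Iq Ip].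
  have qpC := complex_line_comm _ _ _ Iq Ip.
  rewrite (reg_eval_pow_split 1 0 q q) ?addr0 ?mulr1 ?mul1r ?mulr0 ?mul0r//.
  by rewrite addr0 qnormX mulr_natl mulr2n lerDl exprn_ge0.
rewrite sigma_noline//.
have [I SI Ip] := complex_line_exists p.
have [J SJ [x [y qE]]] := complex_line_exists q.
pose al : quat R := 2^-1 *: (1 - J * I).
pose be : quat R := 2^-1 *: (1 - J * - I).
pose u : quat R := x%:A + y *: I; pose v : quat R := x%:A + y *: - I.
have Iu : complex_line I u by exists x, y.
have Iv : complex_line I v by exists x, (- y); rewrite scaleNr -scalerN.
have JJ : J * J = - 1 by exact: SJ.
have II : I * I = - 1 by exact: SI.
have NII : (- I) * (- I) = - 1 by rewrite mulrNN.
(* [omega] sees only real parts and moduli of imaginary parts, so [omega w p] equals [omega q p]. *)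
have le_pow w z : `|z| = `|y| -> w = x%:A + z *: I ->
    `|(w - p) ^+ k| <= omega q p ^+ k.
  move=> zy ->; rewrite qnormX lerXn2r ?nnegrE ?sqrtr_ge0//.
  apply: le_trans (norm_le_omega _ _) _.
  by rewrite /omega qE !complex_line_Re// !complex_line_Im// zy.
(* The weights [al] and [be] have modulus at most 1, whence the factor 2. *)
have le1 (z : quat R) : `|z| = 1 -> `|2^-1 *: (1 + z)| <= 1.
  move=> z1; rewrite normrZ ger0_norm ?invr_ge0//.
  have := ler_normD (1 : quat R) z; rewrite z1 qnorm1; lra.
have JI1 : `|J * I| = 1 by rewrite qnormM !qnorm_imag// mulr1.
rewrite (reg_eval_pow_split al be u v).
- rewrite (le_trans (ler_normD _ _))// !qnormM mulr_natl mulr2n lerD//.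
    rewrite -[leRHS]mul1r ler_pM// ?le_pow//; last exact: (le_pow _ y).
    by apply: le1; rewrite normrN.
  rewrite -[leRHS]mul1r ler_pM//.
    by apply: le1; rewrite mulrN opprK.
  by apply: (le_pow _ (- y)); rewrite ?normrN// scaleNr -scalerN.
- rewrite /al /be -scalerDr mulrN opprK addrACA addNr addr0.
  by rewrite scalerDr -scalerDl (_ : 2^-1 + 2^-1 = 1 :> R) ?scale1r//; lra.
- by rewrite qE; exact: complex_line_intertwine.
- by rewrite qE; exact: complex_line_intertwine.
- exact: complex_line_comm Iu Ip.
- exact: complex_line_comm Iv Ip.
Qed.

End RegularEvaluation.

(** * Absolute convergence, root test and binomial bound *)

Section QuaternionSeries.
Context {R : realType}.
Implicit Types (u : nat -> quat R) (c l : quat R).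

(** Each real coordinate is bounded by the modulus, so the four coordinate series converge
    absolutely; the series is reassembled from them along the basis [e]. *)
Lemma quat_normed_cvg u : cvgn (series (fun n => `|u n|)) -> cvgn (series u).
Proof.
move=> cu; have comp (f : quat R -> R) : (forall q, `|f q| <= `|q|) ->
    cvgn (series (fun n => f (u n))).
  move=> fle; apply: (@normed_cvg R R^o).
  by apply: series_le_cvg cu => n //=; exact: fle.
have abs_le (x y : R) : x ^+ 2 <= y -> `|x| <= Num.sqrt y.
  move=> xy; rewrite -sqrtr_sqr ler_sqrt// (le_trans _ xy) ?sqr_ge0//.
have c1 : cvgn (series (fun n => qRe (u n))).
  apply: comp => q; rewrite quat_normE; apply: abs_le.
  by rewrite -!addrA lerDl !addr_ge0 ?sqr_ge0.
have c2 : cvgn (series (fun n => qi (u n))).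
  apply: comp => q; rewrite quat_normE; apply: abs_le.
  by rewrite (addrC (qRe q ^+ 2)) -!addrA lerDl !addr_ge0 ?sqr_ge0.
have c3 : cvgn (series (fun n => qj (u n))).
  apply: comp => q; rewrite quat_normE; apply: abs_le.
  by rewrite addrAC lerDr !addr_ge0 ?sqr_ge0.
have c4 : cvgn (series (fun n => qk (u n))).
  apply: comp => q; rewrite quat_normE; apply: abs_le.
  by rewrite lerDr !addr_ge0 ?sqr_ge0.
pose e := (Quat 1 0 0 0 : quat R, Quat 0 1 0 0 : quat R,
  Quat 0 0 1 0 : quat R, Quat 0 0 0 1 : quat R).
suff -> : series u = fun n => series (fun n => qRe (u n)) n *: e.1.1.1 +
    series (fun n => qi (u n)) n *: e.1.1.2 +
    series (fun n => qj (u n)) n *: e.1.2 + series (fun n => qk (u n)) n *: e.2.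
  by do 3?apply: is_cvgD; exact: is_cvgZr_tmp.
apply/funext => n; rewrite /series /= !scaler_suml -!big_split /=.
apply: eq_bigr => i _; case: (u i) => a b c d; rewrite !quatE.
by apply: quat_ext => /=; ring.
Qed.

Lemma cvg_qmull u c l : u @ \oo --> l -> (fun n => c * u n) @ \oo --> c * l.
Proof.
move=> ul; apply/cvgrPdist_le => e e0.
(* Adding 1 keeps the divisor positive when [c = 0]. *)
have c1 : 0 < `|c| + 1 by rewrite ltr_wpDl.
move/cvgrPdist_le: ul => /(_ (e / (`|c| + 1)) (divr_gt0 e0 c1)).
apply: filterS => n un; rewrite -mulrBr qnormM.
rewrite (le_trans (ler_wpM2l _ un))// mulrCA ler_piMr ?(ltW e0)//.
by rewrite ler_pdivrMr// mul1r lerDl.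
Qed.

(** Root test: for some [r > rho] below the radius, eventually [|a n|] is at most [r^-n], and a
    geometric series of ratio [rho / r] dominates. *)
Lemma summable_lt_radius (a : nat -> quat R) (rho : R) : 0 <= rho ->
    (rho%:E < convergence_radius a)%E ->
  cvgn (series (fun n => `|a n| * rho ^+ n)).
Proof.
move=> rho0; rewrite /convergence_radius; set L := limn_esup _ => rhoL.
have [r rhor Lr] : exists2 r, rho < r & (L < r^-1%:E)%E.
  move: rhoL; case: (inveP L) => [_|||x x0].
  - by exists (rho + 1); rewrite ?ltrDl// lte_fin invr_gt0 ltr_wpDl.
  - by rewrite lte_fin ltNge rho0.
  - by rewrite ltNge leNye.
  - rewrite lte_fin => rhox; have x'0 := le_lt_trans rho0 rhox.
    have {}x0 : 0 < x by rewrite -invr_gt0.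
    exists ((rho + x^-1) / 2); first by rewrite midf_lt.
    rewrite lte_fin -[ltLHS]invrK ltf_pV2 ?posrE ?midf_lt//.
    by rewrite divr_gt0// ltr_wpDl.
have r0 := le_lt_trans rho0 rhor.
(* The limsup is an infimum over neighbourhoods of infinity: some [V] has its supremum below [r^-1],
   and [V] contains all [n >= N]. *)
have [_ [V [N _ NV] <-]] := ereal_inf_lt Lr.
move=> supV; pose v := geometric 1 (rho / r).
(* The strict inequality excludes [n = 0], whose exponent [n%:R^-1] would be the default 0. *)
have le_v n : (N < n)%N -> `|a n| * rho ^+ n <= v n.
  move=> Nn; have n0 : n%:R != 0 :> R.
    by rewrite pnatr_eq0 -lt0n (leq_ltn_trans _ Nn).
  have an : `|a n| `^ n%:R^-1 < r^-1.
    rewrite -lte_fin; apply: le_lt_trans supV; apply: ereal_sup_ubound.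
    by exists n => //; apply: NV; exact: ltnW.
  rewrite /v /= mul1r expr_div_n mulrC -exprVn ler_wpM2l ?exprn_ge0//.
  rewrite -[leLHS]powRr1// -(mulVf n0) powRrM powR_mulrn ?powR_ge0//.
  by rewrite lerXn2r ?nnegrE ?powR_ge0 ?invr_ge0 ?(ltW r0)// ltW.
have v0 n : 0 <= v n by rewrite /v /= mul1r exprn_ge0// divr_ge0// ltW.
(* The domination by [v] is known only past [N]; zeroing the other terms does not affect
   convergence. *)
pose w n := if (N < n)%N then `|a n| * rho ^+ n else 0.
have cw : cvgn (series w).
  apply: (series_le_cvg _ v0); rewrite /w.
  - by move=> n; case: ifP => // _; rewrite mulr_ge0 ?exprn_ge0.
  - by move=> n; case: ifP => [/le_v|_].
  apply: is_cvg_geometric_series.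
  by rewrite ger0_norm ?divr_ge0 ?(ltW r0)// ltr_pdivrMr// mul1r.
rewrite -(is_cvg_series_restrict N.+1).
rewrite -(is_cvg_series_restrict N.+1) in cw.
suff <- : (fun n => \sum_(N.+1 <= k < n) w k) =
  (fun n => \sum_(N.+1 <= k < n) `|a k| * rho ^+ k) by [].
by apply/funext => n; apply: eq_big_nat => k /andP[Nk _]; rewrite /w Nk.
Qed.

(** Serves for binomial sums, whose terms vanish for [k > n]: their range becomes independent of
    [n]. *)
Lemma sum_ord_widen_eq0 {V : nmodType} (F : nat -> V) n N : (n < N)%N ->
  (forall k, (n < k)%N -> F k = 0) -> \sum_(k < n.+1) F k = \sum_(k < N) F k.
Proof.
move=> nN F0; rewrite (big_ord_widen N F nN) big_mkcond /=.
by apply: eq_bigr => k _; case: ltnP => // nk; rewrite F0.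
Qed.

Lemma le_binomial (x t : R) n N : 0 <= x -> 0 <= t ->
  \sum_(k < N) t ^+ k * (x ^+ (n - k) *+ 'C(n, k)) <= (x + t) ^+ n.
Proof.
move=> x0 t0; pose F k := t ^+ k * (x ^+ (n - k) *+ 'C(n, k)).
have F0 k : 0 <= F k by rewrite mulr_ge0 ?mulrn_wge0 ?exprn_ge0.
(* Enlarging the range from [N] adds nonnegative terms; the terms past [n] vanish, which leaves the
   binomial expansion. *)
apply: (@le_trans _ _ (\sum_(k < maxn N n.+1) F k)).
  rewrite (big_ord_widen _ F (leq_maxl N n.+1)) big_mkcond ler_sum//= => k _.
  by case: ifP.
rewrite -(@sum_ord_widen_eq0 _ F n) ?leq_maxr//; last first.
  by move=> k nk; rewrite /F bin_small// mulr0n mulr0.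
rewrite exprDn ler_sum// => k _; rewrite /F mulrnAr mulrC//.
Qed.

End QuaternionSeries.

(** * Rearrangement into a regular series centred at [p] *)

Section TaylorExpansion.
Context {R : realType}.
Implicit Types (a : nat -> quat R) (p q : quat R).

(** For [k > n] the truncated [n - k] is harmless, as ['C(n, k)] is 0. *)
Definition taylor_term a p k n : quat R := p ^+ (n - k) *+ 'C(n, k) * a n.

Definition taylor_coef a p k : quat R := limn (series (taylor_term a p k)).

(** By the binomial formula, [t ^+ k] times the modulus of the term is at most
    [|a n| * (|p| + t)^n], which is summable; then divide by [t ^+ k]. *)
Lemma cvg_taylor_coef a p k (t : R) : 0 < t ->
    (((`|p| + t)%:E) < convergence_radius a)%E ->
  series (taylor_term a p k) @ \oo --> taylor_coef a p k.
Proof.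
move=> t0 pt; apply: quat_normed_cvg.
have pt0 : 0 <= `|p| + t by rewrite addr_ge0 ?(ltW t0).
have tk : 0 < t ^+ k by rewrite exprn_gt0.
have := is_cvg_seriesZ (k := (t ^+ k)^-1) (summable_lt_radius a _ pt0 pt).
apply: series_le_cvg => n /=; first exact: normr_ge0.
  by rewrite mulr_ge0 ?invr_ge0 ?(ltW tk)// mulr_ge0 ?exprn_ge0.
rewrite ler_pdivlMl// qnormM normrMn qnormX mulrA mulrC ler_wpM2l//.
apply: le_trans (le_binomial `|p| t n k.+1 (normr_ge0 _) (ltW t0)).
rewrite big_ord_recr /= lerDr sumr_ge0// => i _.
by rewrite mulr_ge0 ?mulrn_wge0 ?exprn_ge0// ltW.
Qed.

(** Only finite sums are exchanged: the square [k, n < N] contains every nonzero term of the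
    binomial expansions of [q ^+ n] for [n < N]. *)
Lemma power_series_taylor a p q N : power_series a q N =
  \sum_(k < N) reg_eval (reg_pow p k) q * series (taylor_term a p k) N.
Proof.
rewrite /power_series /series /= big_mkord.
under [RHS]eq_bigr do rewrite big_mkord big_distrr.
rewrite exchange_big; apply: eq_bigr => n _.
pose F k := reg_eval (reg_pow p k) q * taylor_term a p k n.
rewrite -(@sum_ord_widen_eq0 _ F n)//; last first.
  by move=> k nk; rewrite /F /taylor_term bin_small// mulr0n mul0r mulr0.
rewrite (reg_eval_binomial p) big_distrl; apply: eq_bigr => k _.
by rewrite /F mulrA.
Qed.

(** The difference runs over [k < N <= n < L], and for each such [n] the moduli of the terms in [k]
    add up to at most [2 * |a n| * (|p| + sigma q p)^n]. *)
Lemma norm_taylor_tail a p q (N L : nat) : (N <= L)%N ->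
  `|\sum_(k < N) reg_eval (reg_pow p k) q * series (taylor_term a p k) L
    - power_series a q N| <=
  2 * \sum_(N <= n < L) `|a n| * (`|p| + sigma q p) ^+ n.
Proof.
move=> NL; rewrite (power_series_taylor a p) -sumrB.
under eq_bigr do rewrite -mulrBr sub_series_geq// big_distrr.
rewrite exchange_big mulr_sumr (le_trans (ler_norm_sum _ _ _))//.
apply: ler_sum => n _; rewrite (le_trans (ler_norm_sum _ _ _))//.
apply: (@le_trans _ _ (2 * (`|a n| * \sum_(k < N)
    sigma q p ^+ k * (`|p| ^+ (n - k) *+ 'C(n, k))))); last first.
  rewrite !ler_wpM2l// le_binomial// (le_trans _ (norm_le_sigma q p))//.
rewrite !mulr_sumr ler_sum// => k _.
rewrite /taylor_term !qnormM normrMn qnormX.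
rewrite [X in _ <= 2 * X]mulrC -[X in _ <= 2 * X]mulrA [leRHS]mulrA.
rewrite ler_wpM2r ?norm_reg_pow// mulr_ge0 ?mulrn_wge0 ?exprn_ge0//.
Qed.

Lemma norm_le_addsigma p q : `|q| <= `|p| + sigma q p.
Proof.
rewrite -[in leLHS](subrKC p q) (le_trans (ler_normD _ _))// lerD2l.
exact: norm_le_sigma.
Qed.

Lemma cvg_power_series a q :
  (`|q|%:E < convergence_radius a)%E -> cvgn (power_series a q).
Proof.
move=> /(summable_lt_radius a _ (normr_ge0 q)) aq; apply: quat_normed_cvg.
suff -> : (fun n => `|q ^+ n * a n|) = (fun n => `|a n| * `|q| ^+ n) by [].
by apply/funext => n; rewrite qnormM qnormX mulrC.
Qed.

(** Convergence of the coefficients is assumed because it comes from a positive [t], while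
    [sigma q p] vanishes at [q = p]. *)
Lemma cvg_taylor a p q : ((`|p| + sigma q p)%:E < convergence_radius a)%E ->
    (forall k, series (taylor_term a p k) @ \oo --> taylor_coef a p k) ->
  series (fun k => reg_eval (reg_pow p k) q * taylor_coef a p k) @ \oo -->
  limn (power_series a q).
Proof.
move=> pq ck.
have s0 : 0 <= sigma q p by rewrite (le_trans _ (norm_le_sigma q p)).
have ps0 : 0 <= `|p| + sigma q p by rewrite addr_ge0.
pose e n := `|a n| * (`|p| + sigma q p) ^+ n.
have ce : cvgn (series e) by exact: summable_lt_radius.
have e0 n : 0 <= e n by rewrite /e mulr_ge0 ?exprn_ge0.
pose f := series (fun k => reg_eval (reg_pow p k) q * taylor_coef a p k).
(* Letting [L] tend to infinity in [norm_taylor_tail] with [N] fixed bounds the difference by a tail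
   of [e]; this does the work of exchanging infinite sums. *)
have bound N :
    `|f N - power_series a q N| <= 2 * (limn (series e) - series e N).
  have cl : (fun L => `|\sum_(k < N) reg_eval (reg_pow p k) q *
      series (taylor_term a p k) L - power_series a q N|) @ \oo -->
      `|\sum_(k < N) reg_eval (reg_pow p k) q * taylor_coef a p k
      - power_series a q N|.
    apply: cvg_norm; apply: cvgB; last exact: cvg_cst.
    apply: cvg_big => [|k _]; first exact: add_continuous.
    exact: cvg_qmull.
  rewrite /f /series /= big_mkord.
  apply: (ler_cvg_to cl (cvg_cst _)); near=> L.
  have NL : (N <= L)%N by near: L; exact: nbhs_infty_ge.
  rewrite (le_trans (norm_taylor_tail a p q N L NL))// ler_wpM2l//.
  rewrite -sub_series_geq// lerB//.
  apply: nondecreasing_cvgn_le => //.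
  by apply: nondecreasing_series => n _ _; exact: e0.
suff f0 : (fun N => f N - power_series a q N) @ \oo --> (0 : quat R).
  have cq : power_series a q @ \oo --> limn (power_series a q).
    apply: cvg_power_series; apply: le_lt_trans pq; rewrite lee_fin.
    exact: norm_le_addsigma.
  have fE : f = (fun N => f N - power_series a q N) \+ power_series a q.
    by apply/funext => N; rewrite /= subrK.
  by rewrite -/f fE -[limn _]add0r; exact: cvgD f0 cq.
apply: norm_cvg0.
have lim0 : (fun N => 2 * (limn (series e) - series e N)) @ \oo --> (0 : R).
  rewrite -(mulr0 2) -[X in 2 * X](subrr (limn (series e))).
  by apply: cvgMl_tmp; apply: cvgB => //; exact: cvg_cst.
apply: (squeeze_cvgr _ (cvg_cst 0) lim0).
by near=> N; rewrite normr_ge0 bound.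
Unshelve. all: end_near.
Qed.

End TaylorExpansion.

(** * Sigma-balls inside the ball of convergence *)

Lemma ereal_lt_add_pos {R : realType} (x : R) (y : \bar R) :
  (x%:E < y)%E -> exists2 t : R, 0 < t & ((x + t)%:E < y)%E.
Proof.
case: y => [y| |//]; last by exists 1; rewrite ?ltry.
rewrite lte_fin => xy; exists ((y - x) / 2).
  by rewrite divr_gt0 ?subr_gt0.
rewrite lte_fin; lra.
Qed.

Lemma sigma_nbhsP {R : realType} (p : quat R) (t : R) (U : set (quat R)) :
  0 < t -> (forall q, sigma q p < t -> U q) -> sigma_nbhs p U.
Proof.
move=> t0 tU; rewrite /sigma_nbhs.
apply: (filterS _ (@nbhsx_ballx R (squat R) p t t0)) => q.
by rewrite ballEmdist /= => pq; apply: tU; rewrite sigma_sym.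
Qed.

(** [limn] takes a default value on divergent sequences, so convergence on [B] is asserted alongside
    analyticity. *)
Theorem theorem1p9 (R : realType) (a : nat -> quat R) (rho : \bar R) :
  rho = convergence_radius a ->
  let B := [set q : quat R | (`|q|%:E < rho)%E] in
  (forall q, B q -> cvgn (power_series a q)) /\
  sigma_analytic B (fun q => limn (power_series a q)).
Proof.
move=> -> B; split=> [q|]; first exact: cvg_power_series.
(* As [|q| <= |p| + sigma q p], the sigma-ball of radius [t] at [p] lies in [B] once [|p| + t] is
   below the radius of convergence. *)
have ball_B p t q : ((`|p| + t)%:E < convergence_radius a)%E -> sigma q p < t ->
    ((`|p| + sigma q p)%:E < convergence_radius a)%E.
  by move=> pt qt; apply: lt_trans pt; rewrite lte_fin ltrD2l.
have sub_B p q : ((`|p| + sigma q p)%:E < convergence_radius a)%E -> B q.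
  by apply: le_lt_trans; rewrite lee_fin norm_le_addsigma.
split=> [|p Bp].
  rewrite /sigma_open openE => p Bp.
  have [t t0 pt] := ereal_lt_add_pos _ _ Bp.
  apply: (sigma_nbhsP p t B t0) => q qt; exact: sub_B (ball_B _ _ _ pt qt).
(* A single [t] yields both the convergence of all coefficients and the expansion on the whole
   sigma-ball. *)
have [t t0 pt] := ereal_lt_add_pos _ _ Bp.
exists [set q | sigma q p < t], (taylor_coef a p); split.
- exact: (sigma_nbhsP p t _ t0).
- by move=> q qt; exact: sub_B (ball_B _ _ _ pt qt).
- move=> q qt; apply: cvg_taylor; first exact: ball_B pt qt.
  by move=> k; exact: cvg_taylor_coef pt.
Qed.
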